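(* Let $u$ be a unitary element of the Cuntz algebra $\mathcal{O}_2$ such that $\lambda_u(F)\subseteq V$, where $\lambda_u$ is the unital $*$-endomorphism of $\mathcal{O}_2$ with $\lambda_u(S_i)=uS_i$ for $i=1,2$. Then $u\in V$ if and only if $\lambda_u(\mathcal{D}_2)\subseteq\mathcal{D}_2$ and $\lambda_u(S_1S_2^* )\in\mathcal{V}_2$.
   Context: The Cuntz algebra $\mathcal{O}_2$ is the $C^*$-algebra generated by two isometries $S_1,S_2$ with $S_1S_1^*+S_2S_2^*=1$. For every unitary $u\in\mathcal{O}_2$ there is a unique unital $*$-endomorphism $\lambda_u$ of $\mathcal{O}_2$ with $\lambda_u(S_i)=uS_i$, $i=1,2$. $W_2$ is the set of all finite words (multi-indices, including the empty word $\emptyset$) in the alphabet $\{1,2\}$. For $\mu=\mu_1\ldots\mu_k\in W_2$ put $S_\mu=S_{\mu_1}\cdots S_{\mu_k}$, $S_\emptyset=1$, and $P_\mu=S_\mu S_\mu^*$. The diagonal $\mathcal{D}_2$ is the $C^*$-subalgebra of $\mathcal{O}_2$ generated by all $P_\mu$, $\mu\in W_2$. $\mathcal{V}_2$ is the set of all elements of $\mathcal{O}_2$ of the form $\sum_{(\alpha,\beta)\in\mathcal{J}}S_\alpha S_\beta^*$ with $\mathcal{J}$ a finite collection of pairs in $W_2\times W_2$. The Thompson groups are realized inside the unitary group of $\mathcal{O}_2$. $V$ is the group of all unitaries of $\mathcal{O}_2$ belonging to $\mathcal{V}_2$. For $u=\sum_{(\alpha,\beta)\in\mathcal{J}}S_\alpha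 S_\beta^*\in V$ put $\mathcal{J}_1=\{\alpha:(\alpha,\beta)\in\mathcal{J}\}$ and $\mathcal{J}_2=\{\beta:(\alpha,\beta)\in\mathcal{J}\}$; unitarity means $\sum_{\alpha\in\mathcal{J}_1}P_\alpha=1=\sum_{\beta\in\mathcal{J}_2}P_\beta$. $F$ is the subgroup of those $u\in V$ for which the association $\mathcal{J}_1\ni\alpha\mapsto\beta\in\mathcal{J}_2$ (with $(\alpha,\beta)\in\mathcal{J}$) respects the lexicographic order on $W_2$. *)

(* Defs.v *)
From HB Require Import structures.
From mathcomp Require Import all_boot all_order all_algebra finmap.
From mathcomp Require Import all_classical all_reals.
From mathcomp Require Import topology normedtype complex.

Set Implicit Arguments.
Unset Strict Implicit.
Unset Printing Implicit Defensive.

Import Order.TTheory GRing.Theory Num.Theory.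
Import numFieldNormedType.Exports.

Local Open Scope classical_set_scope.
Local Open Scope ring_scope.

(* Unital C*-algebras with 1 != 0; K is the field R[i] of complex numbers in all
   uses below. As everywhere in the normedtype hierarchy, the norm takes its
   values in K; these are automatically real and nonnegative. The structure is a
   record over a complete normed module because a join of algType and
   completeNormedModType is blocked by numDomainType; both structures are put on
   the carrier below. *)
Record cstarAlgType (K : numClosedFieldType) := CstarAlgType {
  cstar_base : completeNormedModType K ;
  cstar_one : cstar_base ;
  cstar_mul : cstar_base -> cstar_base -> cstar_base ;
  cstar_star : cstar_base -> cstar_base ;
  cstar_mulA : associative cstar_mul ;
  cstar_mul1l : left_id cstar_one cstar_mul ;
  cstar_mul1r : right_id cstar_one cstar_mul ;
  cstar_mulDl : left_distributive cstar_mul +%R ;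
  cstar_mulDr : right_distributive cstar_mul +%R ;
  cstar_one_neq0 : cstar_one != 0 ;
  cstar_scaleAl : forall (a : K) x y,
    a *: cstar_mul x y = cstar_mul (a *: x) y ;
  cstar_scaleAr : forall (a : K) x y,
    a *: cstar_mul x y = cstar_mul x (a *: y) ;
  cstar_starK : involutive cstar_star ;
  cstar_starD : {morph cstar_star : x y / x + y} ;
  cstar_starZ : forall (a : K) x, cstar_star (a *: x) = a^* *: cstar_star x ;
  cstar_starM : forall x y,
    cstar_star (cstar_mul x y) = cstar_mul (cstar_star y) (cstar_star x) ;
  cstar_normM : forall x y, `|cstar_mul x y| <= `|x| * `|y| ;
  cstar_norm_star : forall x, `|cstar_mul (cstar_star x) x| = `|x| ^+ 2 }.

Definition cstar_sort (K : numClosedFieldType) (A : cstarAlgType K) : Type :=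
  cstar_base A.
Coercion cstar_sort : cstarAlgType >-> Sortclass.

Section CstarAlgTheory.
Variables (K : numClosedFieldType) (A : cstarAlgType K).

HB.instance Definition _ :=
  CompleteNormedModule.copy (cstar_sort A) (cstar_base A).

HB.instance Definition _ := GRing.Zmodule_isNzRing.Build (cstar_sort A)
  (@cstar_mulA K A) (@cstar_mul1l K A) (@cstar_mul1r K A)
  (@cstar_mulDl K A) (@cstar_mulDr K A) (@cstar_one_neq0 K A).

HB.instance Definition _ := GRing.Lmodule_isLalgebra.Build K (cstar_sort A)
  (@cstar_scaleAl K A).

HB.instance Definition _ := GRing.Lalgebra_isAlgebra.Build K (cstar_sort A)
  (@cstar_scaleAr K A).

Definition star (x : A) : A := cstar_star x.

Lemma starK : involutive star.
Proof. exact: cstar_starK. Qed.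

Lemma starD : {morph star : x y / x + y}.
Proof. exact: cstar_starD. Qed.

Lemma starZ (a : K) (x : A) : star (a *: x) = a^* *: star x.
Proof. exact: cstar_starZ. Qed.

Lemma starM (x y : A) : star (x * y) = star y * star x.
Proof. exact: cstar_starM. Qed.

Lemma cstar_normM_le (x y : A) : `|x * y| <= `|x| * `|y|.
Proof. exact: cstar_normM. Qed.

Lemma cstar_norm_starM (x : A) : `|star x * x| = `|x| ^+ 2.
Proof. exact: cstar_norm_star. Qed.

End CstarAlgTheory.

Section Cstar.
Variables (K : numClosedFieldType) (A : cstarAlgType K).
Implicit Types (B X : set A) (u : A).

Definition unitary u : Prop := star u * u = 1 /\ u * star u = 1.

Record cstar_subalgebra B : Prop := CstarSubalgebra {
  cstar_sub0 : B 0 ;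
  cstar_subD : forall x y, B x -> B y -> B (x + y) ;
  cstar_subZ : forall (a : K) x, B x -> B (a *: x) ;
  cstar_subM : forall x y, B x -> B y -> B (x * y) ;
  cstar_sub_star : forall x, B x -> B (star x) ;
  cstar_sub_closed : closed B }.

Definition cstar_generated X : set A := smallest cstar_subalgebra X.

End Cstar.

(* Words in a two-letter alphabet: the letters 1, 2 are the ordinals 0, 1. *)
Notation word := (seq 'I_2).

(* Lexicographic order; a proper prefix precedes its extensions, but this
   convention plays no role on sets of pairwise incomparable words. *)
Definition word_le (a b : word) : bool :=
  ((a : Order.SeqLexiOrder.type_ 'I_2) <= b)%O.

Section Cuntz.
Variables (R : realType) (A : cstarAlgType R[i]) (S : 'I_2 -> A).

(* A is the Cuntz algebra O_2, with generating isometries S ord0 and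
   S ord_max. *)
Record cuntz_algebra : Prop := CuntzAlgebra {
  cuntz_isometry : forall i, star (S i) * S i = 1 ;
  cuntz_sum : \sum_(i < 2) S i * star (S i) = 1 ;
  cuntz_generated : cstar_generated (range S) = setT }.

Definition Sword (mu : word) : A := \prod_(i <- mu) S i.

Definition Pword (mu : word) : A := Sword mu * star (Sword mu).

Definition cuntz_diagonal : set A := cstar_generated (range Pword).

Definition word_sum (J : {fset word * word}) : A :=
  \sum_(p <- J) Sword p.1 * star (Sword p.2).

Definition calV : set A := range word_sum.

Definition thompsonV : set A := [set u | unitary u /\ calV u].

(* Since word_le is antisymmetric, the condition on J also says that p.1
   determines p.2, i.e., that J is the graph of a map. *)
Definition thompsonF : set A :=
  [set u | thompsonV u /\ exists2 J : {fset word * word}, u = word_sum J &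
    forall p q, p \in J -> q \in J -> word_le p.1 q.1 -> word_le p.2 q.2].

Definition cuntz_endomorphism (u : A) (lambda : {lrmorphism A -> A}) : Prop :=
  (forall x, lambda (star x) = star (lambda x)) /\
  (forall i, lambda (S i) = u * S i).

End Cuntz.

(* Main.v *)
Require Import Defs.
From mathcomp Require Import all_boot all_order all_algebra finmap.
From mathcomp Require Import all_classical all_reals.
From mathcomp Require Import topology normedtype complex.
From mathcomp Require Import zify ring.

(** Why the equivalence holds.

    The set V_2 is closed under sums, products and adjoints ([calVD], [calVM],
    [calV_star]). This is not immediate, because a finite collection of pairs
    has no multiplicities; but S_a S_b^* is also the sum of the S_ac S_bc^*
    over all words c of a fixed length, so a repeated term can be rewritten with
    words that are longer than all those already present. Hence V_2 consists of
    all finite sums of terms S_a S_b^*, repetitions allowed.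

    If u is in V, then lambda_u (S_i) = u S_i is in V_2, and so is
    lambda_u (S_1 S_2^* ). Each lambda_u (S_mu) is an isometry x in V_2, and the
    range projection x x^* of such an isometry lies in D_2
    ([calV_isometry_range]): for words b of a large fixed length, x S_b is an
    isometry and a finite sum of elements S_a, and such a sum has a single term
    ([isometry_word_sum]), so x x^*, being the sum of the (x S_b)(x S_b)^*, is a
    sum of projections P_a. Thus lambda_u maps every P_mu into D_2, and
    D_2 into D_2 because a *-homomorphism is continuous. Continuity is proved
    directly ([star_morph_le]): a selfadjoint y of norm at most 1/2 is the mean
    of a unitary v = y + i sqrt(1 - y^2) and its adjoint, and unitaries go to
    unitaries, which have norm 1.

    Conversely, S_1 and S_2 are *-polynomials in e = S_1 S_2^* and the element
    x = S_11 S_1^* + S_12 S_21^* + S_2 S_22^* of F ([S_first_generated]), with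
    coefficients 1. So if lambda_u (e) is in V_2 and lambda_u (x) is in V, then
    both lambda_u (S_i) are in V_2, and so is their combination
    u = lambda_u (S_1) S_1^* + lambda_u (S_2) S_2^*. *)

Set Implicit Arguments.
Unset Strict Implicit.
Unset Printing Implicit Defensive.

Import numFieldNormedType.Exports.
Import Order.TTheory GRing.Theory Num.Theory.

Local Open Scope classical_set_scope.
Local Open Scope ring_scope.

(** * Adjoints and norms *)

Section Star.
Variables (K : numClosedFieldType) (A : cstarAlgType K).
Implicit Types x y : A.

Lemma star0 : star (0 : A) = 0.
Proof. by apply: (addrI (star (0 : A))); rewrite -starD !addr0. Qed.

Lemma starN x : star (- x) = - star x.
Proof. by apply: (addrI (star x)); rewrite -starD !subrr star0. Qed.

Lemma starB x y : star (x - y) = star x - star y.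
Proof. by rewrite starD starN. Qed.

Lemma star1 : star (1 : A) = 1.
Proof. by have := starM (star 1) (1 : A); rewrite mulr1 starK mulr1. Qed.

Lemma star_sum (I : Type) (r : seq I) (F : I -> A) :
  star (\sum_(i <- r) F i) = \sum_(i <- r) star (F i).
Proof. by apply: (big_morph (@star K A)); [exact: starD | exact: star0]. Qed.

Lemma star_mul_eq0 x : star x * x = 0 -> x = 0.
Proof.
move=> x0; apply/eqP; rewrite -normr_eq0 -sqrf_eq0.
by rewrite -cstar_norm_starM x0 normr0.
Qed.

Lemma norm_star_le x : `|x| <= `|star x|.
Proof.
have [->|x0] := eqVneq x 0; first by rewrite normr0.
have x_gt0 : 0 < `|x| by rewrite normr_gt0.
by rewrite -(ler_pM2r x_gt0) -expr2 -cstar_norm_starM cstar_normM_le.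
Qed.

Lemma norm_star x : `|star x| = `|x|.
Proof.
by apply/eqP; rewrite eq_le -{2}[x]starK !norm_star_le.
Qed.

Lemma norm1 : `|1 : A| = 1.
Proof.
have n0 : `|1 : A| != 0 by rewrite normr_eq0 oner_neq0.
apply: (mulIf n0); rewrite mul1r -expr2 -cstar_norm_starM.
by rewrite star1 mulr1.
Qed.

Lemma norm_unitary x : unitary x -> `|x| = 1.
Proof.
case=> xx _; apply/eqP; rewrite -(eqrXn2 (n := 2)) //.
by rewrite -cstar_norm_starM xx norm1 expr1n.
Qed.

Lemma generated_subalgebra (X : set A) : cstar_subalgebra (cstar_generated X).
Proof.
split.
- by move=> B [BA _]; exact: cstar_sub0.
- by move=> x y Bx By B X_B; apply: cstar_subD (Bx _ X_B) (By _ X_B); case: X_B.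
- by move=> k x Bx B X_B; apply: cstar_subZ (Bx _ X_B); case: X_B.
- by move=> x y Bx By B X_B; apply: cstar_subM (Bx _ X_B) (By _ X_B); case: X_B.
- by move=> x Bx B X_B; apply: cstar_sub_star (Bx _ X_B); case: X_B.
- by apply: closed_bigI => B [BA _]; exact: cstar_sub_closed.
Qed.

End Star.

(** * Words in the generating isometries *)

Section Words.
Variables (R : realType) (A : cstarAlgType R[i]) (S : 'I_2 -> A).
Hypothesis hS : cuntz_algebra S.
Implicit Types (a b c : word) (p q : word * word) (x y : A).

Lemma I2P (P : 'I_2 -> Prop) : P ord0 -> P ord_max -> forall i, P i.
Proof.
move=> P0 P1 i; case: (unliftP ord0 i) => [j|] -> //.
by rewrite (ord1 j) (_ : lift _ _ = ord_max) //; apply: val_inj.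
Qed.

Lemma cuntz_sum2 :
  S ord0 * star (S ord0) + S ord_max * star (S ord_max) = 1.
Proof.
rewrite -(cuntz_sum hS) !big_ord_recl big_ord0 addr0.
by congr (_ + S _ * star (S _)); apply: val_inj.
Qed.

(** Compressing S_1 S_1^* + S_2 S_2^* = 1 by S_1 leaves x^* x = 0 for
    x = S_2^* S_1, and the C*-identity gives x = 0. *)
Lemma cuntz_orthogonal i j : star (S i) * S j = (i == j)%:R.
Proof.
have S10 : star (S ord_max) * S ord0 = 0.
  apply: star_mul_eq0; rewrite starM starK.
  have /(congr1 (fun x => star (S ord0) * x * S ord0)) := cuntz_sum2.
  rewrite mulr1 mulrDr mulrDl !mulrA (cuntz_isometry hS) mul1r -mulrA.
  by rewrite (cuntz_isometry hS) => /(canRL (addKr _)); rewrite addNr !mulrA.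
have S01 : star (S ord0) * S ord_max = 0.
  by rewrite -[LHS]starK starM starK S10 star0.
by elim/I2P: i; elim/I2P: j; rewrite ?(cuntz_isometry hS).
Qed.

Lemma Sword0 : Sword S [::] = 1.
Proof. by rewrite /Sword big_nil. Qed.

Lemma Sword_cons i a : Sword S (i :: a) = S i * Sword S a.
Proof. by rewrite /Sword big_cons. Qed.

Lemma Sword_cat a b : Sword S (a ++ b) = Sword S a * Sword S b.
Proof. by rewrite /Sword big_cat. Qed.

Lemma star_Sword_cons i j a b :
  star (Sword S (i :: a)) * Sword S (j :: b) =
  (i == j)%:R * (star (Sword S a) * Sword S b).
Proof.
rewrite !Sword_cons starM -mulrA (mulrA (star (S i))) cuntz_orthogonal.
by rewrite !mulr_natl mulrnAr.
Qed.

Lemma Sword_isometry a : star (Sword S a) * Sword S a = 1.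
Proof.
elim: a => [|i a IHa]; first by rewrite Sword0 star1 mulr1.
by rewrite star_Sword_cons eqxx IHa mulr1.
Qed.

(** Only comparable words give a nonzero product, and then the common prefix
    cancels. *)
Lemma star_SwordM a b :
  [\/ exists2 c, b = a ++ c & star (Sword S a) * Sword S b = Sword S c,
      exists2 c, a = b ++ c & star (Sword S a) * Sword S b = star (Sword S c) |
      star (Sword S a) * Sword S b = 0].
Proof.
elim: a b => [|i a IHa] [|j b].
- by apply: Or31; exists [::] => //; rewrite Sword_isometry Sword0.
- by apply: Or31; exists (j :: b) => //; rewrite Sword0 star1 mul1r.
- by apply: Or32; exists (i :: a) => //; rewrite Sword0 mulr1.
rewrite star_Sword_cons; case: eqVneq => [->|_]; last first.
  by apply: Or33; rewrite mul0r.
rewrite mul1r; case: (IHa b) => [[c -> ->]|[c -> ->]|->]; last by apply: Or33.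
- by apply: Or31; exists c.
- by apply: Or32; exists c.
Qed.

Lemma star_Sword_neq k a b :
    (k < size a)%N -> (k < size b)%N -> nth ord0 a k != nth ord0 b k ->
  star (Sword S a) * Sword S b = 0.
Proof.
elim: k a b => [|k IHk] [|i a] [|j b] //= ka kb ab; rewrite star_Sword_cons.
  by rewrite (negbTE ab) mul0r.
by rewrite IHk // mulr0.
Qed.

Fixpoint words n : seq word :=
  if n is n'.+1 then [seq i :: a | i <- enum 'I_2, a <- words n']
  else [:: [::]].

Lemma size_words n a : a \in words n -> size a = n.
Proof.
elim: n a => [|n IHn] a /=; first by rewrite inE => /eqP ->.
by case/allpairsP => -[i b] /= [_ /IHn <- ->].
Qed.

Lemma uniq_words n : uniq (words n).
Proof.
elim: n => //= n IHn; apply: allpairs_uniq => //; first exact: enum_uniq.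
by move=> [i a] [j b] _ _ /= [-> ->].
Qed.

Lemma sum_words n : \sum_(a <- words n) Sword S a * star (Sword S a) = 1.
Proof.
elim: n => [|n IHn] /=; first by rewrite big_seq1 Sword0 star1 mulr1.
rewrite big_allpairs_dep /= -[RHS](cuntz_sum hS) big_enum.
apply: eq_bigr => i _; rewrite -{1}(mulr1 (S i)) -IHn mulr_sumr mulr_suml.
by apply: eq_bigr => a _; rewrite Sword_cons starM !mulrA.
Qed.

(** * The set V_2 of finite sums of monomials *)

Definition monomial p : A := Sword S p.1 * star (Sword S p.2).

(** Inserting the sum of the P_c over all words c of length n between S_a and
    S_b^* splits the monomial of (a, b) into those of the pairs (ac, bc). *)
Definition refinement n p : seq (word * word) :=
  [seq (p.1 ++ c, p.2 ++ c) | c <- words n].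

Lemma monomial_refinement n p :
  monomial p = \sum_(q <- refinement n p) monomial q.
Proof.
rewrite big_map /monomial -{1}(mulr1 (Sword S p.1)) -(sum_words n).
rewrite mulr_sumr mulr_suml; apply: eq_bigr => c _.
by rewrite !Sword_cat starM !mulrA.
Qed.

Lemma word_sum_uniq (s : seq (word * word)) : uniq s ->
  word_sum S [fset p | p in s]%fset = \sum_(p <- s) monomial p.
Proof. by move=> s_uniq; apply/perm_big/uniq_perm => // p; rewrite !inE. Qed.

Lemma calV_uniq_sum (s : seq (word * word)) :
  uniq s -> calV S (\sum_(p <- s) monomial p).
Proof. by move=> /word_sum_uniq <-; exists [fset p | p in s]%fset. Qed.

(** The new term may already occur in x. Refining it by words longer than every
    first word in x makes all its pieces new, so that no multiplicity arises. *)
Lemma calVD_monomial x p : calV S x -> calV S (x + monomial p).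
Proof.
move=> [J _ <-]; pose n := (\max_(q <- J) size q.1).+1.
rewrite (monomial_refinement n) /word_sum -big_cat.
apply: calV_uniq_sum; rewrite cat_uniq fset_uniq /=; apply/andP; split.
  apply/hasPn => _ /mapP[c /size_words c_n ->]; apply/negP => qJ.
  have := @leq_bigmax_seq _ _ xpredT (fun q : word * word => size q.1) _ qJ isT.
  by rewrite /= size_cat c_n /n addnS ltnNge leq_addl.
rewrite map_inj_in_uniq ?uniq_words // => c d _ _ [].
by move/eqP; rewrite eqseq_cat // eqxx => /eqP.
Qed.

Lemma calV_sum (s : seq (word * word)) : calV S (\sum_(p <- s) monomial p).
Proof.
elim/last_ind: s => [|s p IHs]; first exact: calV_uniq_sum.
by rewrite big_rcons /=; exact: calVD_monomial.
Qed.

Lemma calVP x : calV S x -> exists s, x = \sum_(p <- s) monomial p.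
Proof. by case=> J _ <-; exists (enum_fset J). Qed.

Lemma calV0 : calV S 0.
Proof. by have := calV_sum [::]; rewrite big_nil. Qed.

Lemma calV_monomial p : calV S (monomial p).
Proof. by have := calV_sum [:: p]; rewrite big_seq1. Qed.

Lemma calVD x y : calV S x -> calV S y -> calV S (x + y).
Proof.
by move=> /calVP[s ->] /calVP[t ->]; rewrite -big_cat; apply: calV_sum.
Qed.

Lemma calV_bigsum (I : Type) (r : seq I) (F : I -> A) :
  (forall i, calV S (F i)) -> calV S (\sum_(i <- r) F i).
Proof. by move=> VF; apply: big_ind => //; [exact: calV0 | exact: calVD]. Qed.

Lemma calV_star x : calV S x -> calV S (star x).
Proof.
move=> /calVP[s ->]; rewrite star_sum; apply: calV_bigsum => p.
by rewrite starM starK; exact: (calV_monomial (p.2, p.1)).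
Qed.

Lemma calV_Sword a : calV S (Sword S a).
Proof.
by have := calV_monomial (a, [::]); rewrite /monomial Sword0 star1 mulr1.
Qed.

Lemma calV_letter i : calV S (S i).
Proof. by rewrite -[S i]mulr1 -Sword0 -Sword_cons; exact: calV_Sword. Qed.

Lemma calVM x y : calV S x -> calV S y -> calV S (x * y).
Proof.
move=> /calVP[s ->] /calVP[t ->]; rewrite mulr_suml; apply: calV_bigsum => p.
rewrite mulr_sumr; apply: calV_bigsum => q.
rewrite /monomial mulrA -(mulrA (Sword S p.1)).
case: (star_SwordM p.2 q.1) => [[c _ ->]|[c _ ->]|->].
- by rewrite -Sword_cat; exact: (calV_monomial (p.1 ++ c, q.2)).
- by rewrite -mulrA -starM -Sword_cat; exact: (calV_monomial (p.1, q.2 ++ c)).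
- by rewrite mulr0 mul0r; exact: calV0.
Qed.

(** * Isometries in V_2 have their range projection in D_2 *)

(** The word 1...12 with m letters 1 has no period p with 1 <= p <= m, since its
    last letter differs from the letter p places before. Compression by its
    isometry therefore kills all S_c with c nonempty of length at most m. *)
Definition separator m : word := rcons (nseq m ord0) ord_max.

Lemma separator_shift m c : (0 < size c <= m)%N ->
  star (Sword S (separator m)) * Sword S (c ++ separator m) = 0.
Proof.
case/andP=> c_gt0 cm.
have sm : size (separator m) = m.+1 by rewrite size_rcons size_nseq.
apply: (@star_Sword_neq m); rewrite ?size_cat ?sm ?addnS ?ltnS ?leq_addl //.
rewrite nth_cat ltnNge cm /= !nth_rcons size_nseq ltnn eqxx.
have -> : (m - size c < m)%N by rewrite ltn_subrL c_gt0 (leq_trans c_gt0 cm).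
by rewrite nth_nseq if_same.
Qed.

Lemma separator_orthogonal m a b : (size a <= m)%N -> (size b <= m)%N ->
  star (Sword S (a ++ separator m)) * Sword S (b ++ separator m) =
  (a == b)%:R.
Proof.
elim: a b => [|i a IHa] [|j b] am bm; rewrite ?cat0s.
- by rewrite Sword_isometry.
- by rewrite separator_shift.
- by rewrite -[LHS]starK starM starK separator_shift ?star0.
rewrite /= star_Sword_cons IHa ?eqseq_cons; try exact: ltnW.
by rewrite -natrM mulnb.
Qed.

(** The product of T^* and T is the sum of the S_a^* S_b over the pairs of terms
    a, b of T. Compressing by a separator turns it into the number of pairs with
    a = b, which is at least the number of terms; as T^* T = 1, there is just
    one term. *)
Lemma isometry_word_sum (s : seq word) (T := \sum_(a <- s) Sword S a) :
  star T * T = 1 -> exists a, T = Sword S a.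
Proof.
move=> TT; pose m := (\max_(a <- s) size a)%N; pose g := Sword S (separator m).
have sm a : a \in s -> (size a <= m)%N.
  by move=> sa; exact: (@leq_bigmax_seq _ _ xpredT (fun a : word => size a)).
have cnt : (\sum_(a <- s) \sum_(b <- s) (a == b))%N%:R = 1 :> A.
  transitivity (star (T * g) * (T * g)); last first.
    by rewrite starM -mulrA (mulrA (star T)) TT mul1r Sword_isometry.
  rewrite mulr_suml star_sum mulr_suml natr_sum.
  rewrite big_seq [RHS]big_seq; apply: eq_bigr => a /sm am.
  rewrite mulr_sumr natr_sum big_seq [RHS]big_seq; apply: eq_bigr => b /sm bm.
  by rewrite -!Sword_cat separator_orthogonal.
(* An algebra with 1 != 0 over a field of characteristic zero contains the
   natural numbers injectively. *)
have {cnt} : (\sum_(a <- s) \sum_(b <- s) (a == b) = 1)%N.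
  apply/eqP; rewrite -(pnatr_eq1 R[i]) -subr_eq0.
  have := oner_neq0 A; apply: contraNT => n1; have := scaler_eq0.
  move/(_ _ _ ((\sum_(a <- s) \sum_(b <- s) (a == b))%N%:R - 1 : R[i]) (1 : A)).
  by rewrite (negbTE n1) scalerBl scaler_nat cnt scale1r subrr eqxx.
rewrite /T; case: s {T TT m g sm} => [|a [|b s]].
- by rewrite big_nil.
- by move=> _; exists a; rewrite big_seq1.
rewrite !big_cons !eqxx; lia.
Qed.

(** A word b at least as long as every second word in x absorbs all the adjoints
    in x. *)
Lemma calV_mul_word x : calV S x ->
  exists n, forall b, size b = n ->
    exists s, x * Sword S b = \sum_(a <- s) Sword S a.
Proof.
move=> /calVP[s ->]; exists (\max_(p <- s) size p.2)%N => b bn.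
rewrite mulr_suml big_seq.
apply: (big_ind (fun x => exists s, x = \sum_(a <- s) Sword S a)).
- by exists [::]; rewrite big_nil.
- by move=> _ _ [t ->] [t' ->]; exists (t ++ t'); rewrite big_cat.
move=> p sp; rewrite /monomial -mulrA.
have := @leq_bigmax_seq _ _ xpredT (fun p : word * word => size p.2) p sp isT.
rewrite -bn; case: (star_SwordM p.2 b) => [[c _ ->] _|[c -> ->]|-> _].
- by exists [:: p.1 ++ c]; rewrite big_seq1 Sword_cat.
- rewrite size_cat -[leqRHS]addn0 leq_add2l leqn0 size_eq0 => /eqP ->.
  by exists [:: p.1]; rewrite big_seq1 Sword0 star1 mulr1.
- by exists [::]; rewrite big_nil mulr0.
Qed.

Lemma calV_isometry_range x : calV S x -> star x * x = 1 ->
  cuntz_diagonal S (x * star x).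
Proof.
move=> Vx xx; have [n xn] := calV_mul_word Vx.
have DA := generated_subalgebra (range (Pword S)).
(* x x^* is the sum over the words b of length n of (x S_b)(x S_b)^*. *)
rewrite -[X in X * _]mulr1 -(sum_words n) mulr_sumr mulr_suml big_seq.
apply: big_ind => [|y z Dy Dz|b /size_words /xn[s xb]].
- exact: cstar_sub0.
- exact: cstar_subD Dy Dz.
have [a xa] : exists a, x * Sword S b = Sword S a.
  rewrite xb; apply: isometry_word_sum; rewrite -xb starM.
  by rewrite -mulrA (mulrA (star x)) xx mul1r Sword_isometry.
move=> B [_]; apply; exists a => //.
by rewrite /Pword -xa starM !mulrA.
Qed.

(** * A generator of Thompson's group F *)

(** The pairs (11, 1), (12, 21), (2, 22) of one of the two standard generators of
    F; they are listed in increasing order of both words. *)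
Definition F_pairs : seq (word * word) :=
  [:: ([:: ord0; ord0], [:: ord0]); ([:: ord0; ord_max], [:: ord_max; ord0]);
      ([:: ord_max], [:: ord_max; ord_max])].

Definition F_generator : A := \sum_(p <- F_pairs) monomial p.

Lemma mulK_cuntz x i : x * star (S i) * S i = x.
Proof. by rewrite -mulrA (cuntz_isometry hS) mulr1. Qed.

Lemma mul0_cuntz x i j : i != j -> x * star (S i) * S j = 0.
Proof. by move=> /negbTE ij; rewrite -mulrA cuntz_orthogonal // ij mulr0. Qed.

Lemma mul_cuntz_sum x y :
  x * S ord0 * star (S ord0) * y + x * S ord_max * star (S ord_max) * y = x * y.
Proof. by rewrite -mulrDl -!mulrA -mulrDr cuntz_sum2 mulr1. Qed.

(** Rules that reduce products of the S_i and S_j^*, once associated to the left,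
    to their normal form. *)
Definition cuntz_simp := (mulK_cuntz, fun x => @mul0_cuntz x ord0 ord_max isT,
  fun x => @mul0_cuntz x ord_max ord0 isT, mul0r, addr0, add0r).

Lemma F_generatorE : F_generator =
  S ord0 * S ord0 * star (S ord0) +
  S ord0 * S ord_max * star (S ord0) * star (S ord_max) +
  S ord_max * star (S ord_max) * star (S ord_max).
Proof.
rewrite /F_generator !big_cons big_nil addr0 /monomial /= !Sword_cons !Sword0.
by rewrite !mulr1 !starM !mulrA addrA.
Qed.

Lemma star_F_generatorE : star F_generator =
  S ord0 * star (S ord0) * star (S ord0) +
  S ord_max * S ord0 * star (S ord_max) * star (S ord0) +
  S ord_max * S ord_max * star (S ord_max).
Proof. by rewrite F_generatorE !starD !starM !starK !mulrA. Qed.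

Lemma F_generator_unitary : unitary F_generator.
Proof.
split; rewrite star_F_generatorE F_generatorE !mulrDl !mulrDr !mulrA.
  by rewrite !cuntz_simp -addrA mul_cuntz_sum cuntz_sum2.
by rewrite !cuntz_simp mul_cuntz_sum cuntz_sum2.
Qed.

Lemma F_generator_in_F : thompsonF S F_generator.
Proof.
split; first by split; [exact: F_generator_unitary | exact: calV_sum].
exists [fset p | p in F_pairs]%fset; first by rewrite word_sum_uniq.
move=> p q; rewrite !(inE, orbF).
by move=> /or3P[] /eqP -> /or3P[] /eqP ->.
Qed.

(** With e = S_1 S_2^* and x the generator of F, x P_1 = S_1 P_1 and
    x^* P_2 = S_2 P_2; so S_1 = S_1 P_1 + e S_2 P_2, where P_1 = e e^* and
    P_2 = e^* e. *)
Lemma S_first_generated (e := S ord0 * star (S ord_max)) :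
  S ord0 = F_generator * (e * star e) + e * star F_generator * (star e * e).
Proof.
rewrite /e star_F_generatorE F_generatorE !starM !starK !mulrA.
rewrite !mulrDl !mulrDr !mulrA !mulrDl !cuntz_simp.
by rewrite -!mulrA -mulrDr cuntz_sum2 mulr1.
Qed.

End Words.

(** * Star-homomorphisms are continuous *)

(** A positive element of R[i] is real, so that the archimedean property of R
    applies. *)
Lemma half_exp_lt (R : realType) (e : R[i]) : 0 < e -> exists n, 2^-1 ^+ n < e.
Proof.
case: e => a b; rewrite ltcE /= => /andP[/eqP -> a_gt0].
have := @upper_nthrootP _ a^-1 _ (leqnn _); set n := Num.bound _ => an.
exists n; have -> : 2^-1 ^+ n = (2^-1 ^+ n)%:C%C :> R[i].
  by rewrite rmorphXn /= fmorphV rmorph_nat.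
by rewrite ltcR exprVn -[ltRHS]invrK ltf_pV2 // posrE ?exprn_gt0 ?invr_gt0.
Qed.

Section Sqrt.
Variables (R : realType) (A : cstarAlgType R[i]).
Implicit Types x y : A.

Local Notation h := (2^-1 : R[i]).

Lemma geometric_cvg (a : nat -> A) :
  (forall n, `|a n.+1 - a n| <= h ^+ n) -> exists p : A, a @ \oo --> p.
Proof.
move=> ah; apply/cvg_ex.
have an n k : `|a (n + k)%N - a n| <= 2 * h ^+ n - 2 * h ^+ (n + k).
  elim: k => [|k IHk]; first by rewrite addn0 !subrr normr0.
  rewrite (le_trans (ler_distD (a (n + k)%N) _ _)) // addnS.
  rewrite (le_trans (lerD (ah _) IHk)) // exprS mulrA divff ?pnatr_eq0 // mul1r.
  by rewrite le_eqVlt; apply/orP; left; apply/eqP; ring.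
apply: cauchy_cvg; apply: cauchy_exP => e e_gt0.
have [n hn] : exists n, h ^+ n < e / 2 by apply: half_exp_lt; rewrite divr_gt0.
exists (a n); exists n => // m /= nm; rewrite -ball_normE /= distrC.
rewrite -(subnKC nm) (le_lt_trans (an _ _)) //.
rewrite ltrBlDr (lt_le_trans (y := e)) //; last first.
  by rewrite lerDl mulr_ge0 // exprn_ge0 // invr_ge0.
by rewrite mulrC -ltr_pdivlMr.
Qed.

Lemma norm_small_eq0 x (C : R[i]) : 0 < C ->
  (forall e, 0 < e -> `|x| <= C * e) -> x = 0.
Proof.
move=> C_gt0 xC; apply/eqP; rewrite -normr_le0; apply/negPn/negP => x_gt0.
have {}x_gt0 : 0 < `|x| by rewrite normr_gt0 -normr_le0.
have := xC (`|x| / (2 * C)); rewrite divr_gt0 ?mulr_gt0 // => /(_ isT).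
rewrite mulrC invfM mulrA divfK ?gt_eqF // -{1}(mulr1 `|x|).
by rewrite ler_pM2l // invf_ge1 // lern1.
Qed.

(** The iteration for the fixed point w = (y^2 + w^2) / 2, that is, for
    w = 1 - sqrt (1 - y^2); on the ball of radius 1/2 it is a contraction of
    ratio 1/2 when y is in that ball. *)
Definition sqrt_seq y n : A := iter n (fun w => h *: (y * y + w * w)) 0.

Lemma sqrt_seqS y n :
  sqrt_seq y n.+1 = h *: (y * y + sqrt_seq y n * sqrt_seq y n).
Proof. by []. Qed.

Lemma half_ge0 : 0 <= h. Proof. by rewrite invr_ge0. Qed.

Lemma sqrt_seq_le y n : `|y| <= h -> `|sqrt_seq y n| <= h.
Proof.
move=> yh; elim: n => [|n IHn] /=; first by rewrite normr0 half_ge0.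
rewrite normrZ ger0_norm ?half_ge0 // -[leRHS]mulr1 ler_wpM2l ?half_ge0 //.
rewrite (le_trans (ler_normD _ _)) //.
have le2 x : `|x| <= h -> `|x * x| <= h.
  move=> xh; rewrite (le_trans (cstar_normM_le _ _)) //.
  rewrite (le_trans (ler_pM _ _ xh xh)) // -[leRHS]mulr1 ler_wpM2l ?half_ge0 //.
  by rewrite invf_le1 // ler1n.
by rewrite [leRHS]splitr mul1r lerD ?le2.
Qed.

Lemma sqrt_seq_dist y n : `|y| <= h ->
  `|sqrt_seq y n.+1 - sqrt_seq y n| <= h ^+ n.
Proof.
move=> yh; elim: n => [|n IHn].
  rewrite expr0 (le_trans (ler_normB _ _)) // (splitr 1) mul1r.
  by rewrite lerD ?sqrt_seq_le.
have -> : sqrt_seq y n.+2 - sqrt_seq y n.+1 =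
    h *: (sqrt_seq y n.+1 * (sqrt_seq y n.+1 - sqrt_seq y n) +
          (sqrt_seq y n.+1 - sqrt_seq y n) * sqrt_seq y n).
  rewrite (sqrt_seqS y n.+1) [X in _ - X]sqrt_seqS -scalerBr.
  congr (_ *: _); rewrite mulrBr mulrBl addrA subrK.
  by rewrite opprD addrACA subrr add0r.
rewrite normrZ ger0_norm ?half_ge0 // exprS ler_wpM2l ?half_ge0 //.
rewrite (le_trans (ler_normD _ _)) // (splitr (h ^+ n)).
rewrite lerD // (le_trans (cstar_normM_le _ _)) //.
  by rewrite mulrC ler_pM ?sqrt_seq_le.
by rewrite ler_pM ?sqrt_seq_le.
Qed.

Lemma star_half x : star (h *: x) = h *: star x.
Proof. by rewrite starZ conj_Creal // ger0_real // half_ge0. Qed.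

(** The element 1 - p is a square root of 1 - y^2. The properties of p pass to
    the limit from the iterates, which are polynomials in y with rational
    coefficients. *)
Lemma exists_one_sub_sqrt y : star y = y -> `|y| <= h ->
  exists p, [/\ star p = p, y * p = p * y & p + p = y * y + p * p].
Proof.
move=> ys yh.
have as_ n : star (sqrt_seq y n) = sqrt_seq y n.
  by elim: n => [|n IHn]; rewrite /= ?star0 // star_half starD !starM ys IHn.
have ay n : y * sqrt_seq y n = sqrt_seq y n * y.
  elim: n => [|n IHn]; rewrite /= ?mulr0 ?mul0r // -scalerAr -scalerAl.
  by rewrite mulrDl mulrDr !mulrA IHn -!mulrA IHn.
have a2 n : sqrt_seq y n.+1 + sqrt_seq y n.+1 =
    y * y + sqrt_seq y n * sqrt_seq y n.
  rewrite sqrt_seqS -scalerDl [X in X *: _](_ : _ = 1) ?scale1r //.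
  by rewrite [RHS]splitr mul1r.
have [p ap] := geometric_cvg (fun n => sqrt_seq_dist n yh).
have {ap} near_p e : 0 < e -> exists n, `|p - sqrt_seq y n| <= e /\
    `|p - sqrt_seq y n.+1| <= e.
  move=> e_gt0; move/cvgrPdist_le: ap => /(_ e e_gt0) [N _ Ne].
  by exists N; split; apply: Ne => /=.
have h1 : h <= 1 by rewrite invf_le1 // ler1n.
exists p; split; apply/eqP; rewrite -subr_eq0; apply/eqP.
- apply: (@norm_small_eq0 _ 2) => // e /near_p[n [pn _]].
  have -> : star p - p = star (p - sqrt_seq y n) - (p - sqrt_seq y n).
    by rewrite starB as_ opprB addrA subrK.
  rewrite (le_trans (ler_normB _ _)) // norm_star mulr_natl mulr2n.
  by rewrite lerD.
- apply: (@norm_small_eq0 _ 2) => // e /near_p[n [pn _]].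
  have -> : y * p - p * y = y * (p - sqrt_seq y n) - (p - sqrt_seq y n) * y.
    by rewrite mulrBr mulrBl ay opprB addrA subrK.
  rewrite (le_trans (ler_normB _ _)) // mulr_natl mulr2n.
  rewrite lerD // (le_trans (cstar_normM_le _ _)) //.
    by rewrite -[leRHS]mul1r ler_pM // (le_trans yh).
  by rewrite -[leRHS]mulr1 ler_pM // (le_trans yh).
- apply: (@norm_small_eq0 _ (2 + (`|p| + 1))) => [|e e_gt0].
    by rewrite ltr_wpDr // addr_ge0.
  have [n [pn pn1]] := near_p e e_gt0.
  have -> : p + p - (y * y + p * p) =
      (p - sqrt_seq y n.+1) + (p - sqrt_seq y n.+1) -
      (p * (p - sqrt_seq y n) + (p - sqrt_seq y n) * sqrt_seq y n).
    rewrite addrACA -opprD a2 mulrBr mulrBl (addrA (p * p - _)) subrK.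
    rewrite -[RHS]addrA -opprD; congr (_ - _).
    by rewrite addrACA subrr addr0.
  rewrite (le_trans (ler_normB _ _)) // [leRHS]mulrDl lerD //.
    by rewrite (le_trans (ler_normD _ _)) // mulr_natl mulr2n lerD.
  rewrite (le_trans (ler_normD _ _)) // [leRHS]mulrDl lerD //.
    by rewrite (le_trans (cstar_normM_le _ _)) // ler_wpM2l.
  rewrite (le_trans (cstar_normM_le _ _)) // mulrC ler_pM //.
  by rewrite (le_trans (sqrt_seq_le _ yh)).
Qed.

(** Take v = y + i sqrt (1 - y^2). *)
Lemma selfadjoint_unitary_mean y : star y = y -> `|y| <= h ->
  exists2 v, unitary v & y + y = v + star v.
Proof.
move=> ys yh; have [p [ps yp pp]] := exists_one_sub_sqrt ys yh.
pose z : A := 1 - p.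
have zs : star z = z by rewrite starB star1 ps.
have yz : y * z = z * y by rewrite mulrBr mulrBl mulr1 mul1r yp.
have yyzz : y * y + z * z = 1.
  rewrite [z * z]mulrBr mulr1 mulrBl mul1r opprB addrACA -opprD pp.
  by rewrite (addrC (y * y) (p * p)) addrKA addrC subrK.
have starv : star (y + 'i *: z) = y - 'i *: z.
  by rewrite starD starZ conjCi ys zs scaleNr.
(* Distributivity must not expand z = 1 - p. *)
clearbody z; have ii : 'i * 'i = -1 :> R[i] by rewrite -expr2 sqrCi.
exists (y + 'i *: z); last by rewrite starv addrACA subrr addr0.
rewrite /unitary starv -yyzz; split; rewrite mulrDl !mulrDr ?mulNr ?mulrN.
  rewrite -!scalerAl -!scalerAr scalerA ii scaleN1r opprK yz.
  by rewrite addrA addrK.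
rewrite -!scalerAl -!scalerAr scalerA ii scaleN1r opprK yz.
by rewrite addrA subrK.
Qed.

End Sqrt.

Section StarMorphism.
Variables (R : realType) (A B : cstarAlgType R[i]) (f : {lrmorphism A -> B}).
Hypothesis f_star : forall x, f (star x) = star (f x).

Lemma morph_unitary v : unitary v -> unitary (f v).
Proof. by case=> vv vv'; rewrite /unitary -f_star -!rmorphM vv vv' rmorph1. Qed.

(** Twice f y is the sum of two unitaries, which have norm 1. *)
Lemma star_morph_half_ball y : star y = y -> `|y| <= 2^-1 -> `|f y| <= 1.
Proof.
move=> ys yh; have [v uv yv] := selfadjoint_unitary_mean ys yh.
have : `|f y + f y| <= 1 + 1.
  have -> : f y + f y = f v + star (f v) by rewrite -f_star -!rmorphD yv.
  rewrite (le_trans (ler_normD _ _)) // norm_star.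
  by rewrite (norm_unitary (morph_unitary uv)).
by rewrite -!mulr2n normrMn -[leLHS]mulr_natl -[leRHS]mulr_natl ler_pM2l.
Qed.

(** Scale y to norm 1/2. *)
Lemma star_morph_selfadjoint_le y : star y = y -> `|f y| <= 2 * `|y|.
Proof.
move=> ys; have [->|y0] := eqVneq y 0; first by rewrite rmorph0 !normr0 mulr0.
have y_gt0 : 0 < `|y| by rewrite normr_gt0.
pose k := (2 * `|y|)^-1.
have k_gt0 : 0 < k by rewrite invr_gt0 mulr_gt0.
have : `|f (k *: y)| <= 1.
  apply: star_morph_half_ball.
    by rewrite starZ ys conj_Creal // realE ltW.
  by rewrite normrZ gtr0_norm // /k invfM -mulrA mulVf ?gt_eqF // mulr1.
by rewrite linearZ normrZ gtr0_norm // ler_pdivrMl ?mulr_gt0 // mulr1.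
Qed.

(** By the C*-identity the bound for the selfadjoint element x^* x suffices. *)
Lemma star_morph_le x : `|f x| <= 2 * `|x|.
Proof.
rewrite -(ler_pXn2r (n := 2)) ?nnegrE ?mulr_ge0 //.
rewrite -cstar_norm_starM -f_star -rmorphM.
rewrite (le_trans (star_morph_selfadjoint_le _)) ?starM ?starK //.
rewrite cstar_norm_starM exprMn ler_wpM2r ?exprn_ge0 //.
by rewrite expr2 ler_peMr // ler1n.
Qed.

Lemma star_morph_continuous : continuous f.
Proof.
move=> x; apply/cvgrPdist_lt => e e_gt0.
near=> y; rewrite -rmorphB (le_lt_trans (star_morph_le _)) // mulrC.
rewrite -ltr_pdivlMr //.
by near: y; apply: cvgr_dist_lt; rewrite ?divr_gt0.
Unshelve. all: by end_near. Qed.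

Lemma preimage_subalgebra (D : set B) :
  cstar_subalgebra D -> cstar_subalgebra (f @^-1` D).
Proof.
move=> DB; split; rewrite /preimage /=.
- by rewrite rmorph0; exact: cstar_sub0.
- by move=> x y Dx Dy; rewrite rmorphD; exact: cstar_subD.
- by move=> k x Dx; rewrite linearZ; exact: cstar_subZ.
- by move=> x y Dx Dy; rewrite rmorphM; exact: cstar_subM.
- by move=> x Dx; rewrite f_star; exact: cstar_sub_star.
- apply: preimage_closed; last exact: cstar_sub_closed.
  by move=> x _; exact: star_morph_continuous.
Qed.

Lemma image_generated (X : set A) (D : set B) : cstar_subalgebra D ->
  f @` X `<=` D -> f @` cstar_generated X `<=` D.
Proof.
move=> DB XD _ [x Xx <-]; apply: (Xx (f @^-1` D)).
by split; [exact: preimage_subalgebra | move=> y Xy; apply: XD; exists y].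
Qed.

End StarMorphism.

(** * The equivalence *)

Section Endomorphism.
Variables (R : realType) (A : cstarAlgType R[i]) (S : 'I_2 -> A).
Hypothesis hS : cuntz_algebra S.
Variables (u : A) (lambda_u : {lrmorphism A -> A}).
Hypothesis hlambda : cuntz_endomorphism S u lambda_u.

Let lambda_star x : lambda_u (star x) = star (lambda_u x).
Proof. by case: hlambda. Qed.

Let lambda_letter i : lambda_u (S i) = u * S i.
Proof. by case: hlambda. Qed.

Let lambdaM x y : lambda_u (x * y) = lambda_u x * lambda_u y.
Proof. exact: rmorphM. Qed.

Lemma endomorphism_diagonal : calV S u ->
  lambda_u @` cuntz_diagonal S `<=` cuntz_diagonal S.
Proof.
move=> Vu; have Vword a : calV S (lambda_u (Sword S a)).
  elim: a => [|i a IHa].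
    by rewrite Sword0 rmorph1 -(Sword0 S); exact: calV_Sword.
  rewrite Sword_cons lambdaM lambda_letter.
  exact: (calVM hS (calVM hS Vu (calV_letter hS i)) IHa).
apply: (image_generated lambda_star); first exact: generated_subalgebra.
move=> _ [_ [a _ <-] <-]; rewrite lambdaM lambda_star.
apply: calV_isometry_range => //.
by rewrite -lambda_star -lambdaM Sword_isometry // rmorph1.
Qed.

(** An endomorphism determines its unitary through
    u = lambda (S_1) S_1^* + lambda (S_2) S_2^*. *)
Lemma calV_endomorphism :
  calV S (lambda_u (S ord0)) -> calV S (lambda_u (S ord_max)) -> calV S u.
Proof.
move=> V0 V1; have VS i : calV S (star (S i)).
  by apply: calV_star => //; exact: calV_letter.
rewrite -[u]mulr1 -(cuntz_sum2 hS) mulrDr !mulrA -!lambda_letter.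
by apply: calVD => //; apply: calVM.
Qed.

End Endomorphism.

Theorem proposition3p19 (R : realType) (A : cstarAlgType R[i]) (S : 'I_2 -> A)
    (hS : cuntz_algebra S) (u : A) (hu : unitary u)
    (lambda_u : {lrmorphism A -> A}) (hlambda : cuntz_endomorphism S u lambda_u)
    (hF : lambda_u @` thompsonF S `<=` thompsonV S) :
  thompsonV S u <->
  (lambda_u @` cuntz_diagonal S `<=` cuntz_diagonal S /\
   calV S (lambda_u (S ord0 * star (S ord_max)))).
Proof.
have [lambda_star lambdaS] := hlambda.
have lambdaM x y : lambda_u (x * y) = lambda_u x * lambda_u y by exact: rmorphM.
have lambdaD x y : lambda_u (x + y) = lambda_u x + lambda_u y by exact: rmorphD.
split=> [[_ Vu]|[_ Ve]].
  split; first exact: endomorphism_diagonal.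
  have VS i : calV S (lambda_u (S i)).
    by rewrite lambdaS; apply: calVM => //; exact: calV_letter.
  by rewrite lambdaM lambda_star; apply: calVM => //; exact: calV_star.
split=> //; set e := S ord0 * star (S ord_max) in Ve.
have [_ Vx] : thompsonV S (lambda_u (F_generator S)).
  by apply: hF; exists (F_generator S) => //; exact: F_generator_in_F.
have Ves : calV S (lambda_u (star e)) by rewrite lambda_star; exact: calV_star.
have S1E := S_first_generated hS; rewrite -/e in S1E.
have S2E : S ord_max = star e * S ord0.
  by rewrite /e starM starK -mulrA (cuntz_isometry hS) mulr1.
clearbody e; have V1 : calV S (lambda_u (S ord0)).
  rewrite S1E lambdaD !lambdaM (lambda_star (F_generator S)).
  apply: (calVD hS); first exact: (calVM hS Vx (calVM hS Ve Ves)).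
  exact: (calVM hS (calVM hS Ve (calV_star hS Vx)) (calVM hS Ves Ve)).
apply: (calV_endomorphism hS hlambda V1).
by rewrite S2E lambdaM; exact: calVM.
Qed.
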